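(* Let $R$ be a commutative ring with unit and let $G$ be a finite group. For every quantization $Q$ of the monoidal category $Mod_R(G)$ there is an element $$q_Q=\sum_{g,h\in G}q_{g,h}\,(g,h)\in R[G\times G]$$ such that for all objects $X,Y$ of $Mod_R(G)$ and all $x\in X$, $y\in Y$, $$Q_{X,Y}(x\otimes y)=q_Q\cdot(x\otimes y)=\sum_{g,h\in G}q_{g,h}\; gx\otimes hy .$$
   Context: $Mod_R(G)$ is the monoidal category of finitely generated $G$-modules over $R$ (equivalently, $R[G]$-modules). The tensor product $X\otimes Y$ is taken over $R$, with $G$-action $g(x\otimes y)=g(x)\otimes g(y)$. The group algebra $R[G\times G]$ acts on $X\otimes Y$ by $(g,h)\cdot(x\otimes y)=gx\otimes hy$. A quantization $Q$ of $Mod_R(G)$ is a natural transformation (not necessarily an isomorphism) of the tensor bifunctor to itself, that is, a family of $G$-module morphisms $Q_{X,Y}:X\otimes Y\to X\otimes Y$, natural in both $X$ and $Y$, satisfying the coherence condition: for all objects $X,Y,Z$, $$Q_{X,Y\otimes Z}\circ(1_X\otimes Q_{Y,Z})=Q_{X\otimes Y,Z}\circ(Q_{X,Y}\otimes 1_Z),$$ where $X\otimes(Y\otimes Z)$ and $(X\otimes Y)\otimes Z$ are identified by the standard associativity isomorphism. *)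

(* Defs.v *)
From HB Require Import structures.
From mathcomp Require Import all_fingroup.
From mathcomp Require Import all_boot all_order all_algebra.
From mathcomp Require Import boolp.

Set Implicit Arguments.
Unset Strict Implicit.
Unset Printing Implicit Defensive.

Import GRing.Theory.
Local Open Scope ring_scope.
Local Open Scope quotient_scope.

Section Tensor.
Variables (R : comPzRingType) (X Y : lmodType R).

(* A word [:: (x1, y1); ...; (xn, yn)] stands for the formal sum of the       *)
(* xi (x) yi; tens_rel is the congruence generated by the relations that      *)
(* present the tensor product.  No formal negatives are needed: the word      *)
(* [:: (- x, y)] is an additive inverse of [:: (x, y)] modulo tens_rel.       *)
Inductive tens_rel : seq (X * Y) -> seq (X * Y) -> Prop :=
| tens_refl s : tens_rel s s
| tens_sym s t : tens_rel s t -> tens_rel t s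
| tens_trans s t u : tens_rel s t -> tens_rel t u -> tens_rel s u
| tens_cat s s' t t' :
    tens_rel s s' -> tens_rel t t' -> tens_rel (s ++ t) (s' ++ t')
| tens_catC s t : tens_rel (s ++ t) (t ++ s)
| tens_zero y : tens_rel [:: (0, y)] [::]
| tens_addl x x' y : tens_rel [:: (x + x', y)] [:: (x, y); (x', y)]
| tens_addr x y y' : tens_rel [:: (x, y + y')] [:: (x, y); (x, y')]
| tens_scale a x y : tens_rel [:: (a *: x, y)] [:: (x, a *: y)].

Definition tens_eqb (s t : seq (X * Y)) : bool := `[< tens_rel s t >].

Lemma tens_eqb_refl : reflexive tens_eqb.
Proof. by move=> s; apply/asboolP; exact: tens_refl. Qed.

Lemma tens_eqb_sym : symmetric tens_eqb.
Proof.
by move=> s t; apply/asboolP/asboolP => h; exact: tens_sym.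
Qed.

Lemma tens_eqb_trans : transitive tens_eqb.
Proof.
move=> t s u /asboolP h1 /asboolP h2; apply/asboolP; exact: tens_trans h1 h2.
Qed.

Canonical tens_equiv := EquivRel tens_eqb tens_eqb_refl tens_eqb_sym tens_eqb_trans.

Definition tens : Type := {eq_quot tens_equiv}.
HB.instance Definition _ := Choice.on tens.
HB.instance Definition _ := EqQuotient.on tens.

Definition tens_of (s : seq (X * Y)) : tens := \pi_tens s.

Lemma tens_ofP s t : tens_of s = tens_of t <-> tens_rel s t.
Proof.
split; first by move/eqmodP/asboolP.
by move=> h; apply/eqmodP/asboolP.
Qed.

Lemma tens_of_repr t : tens_of (repr t) = t.
Proof. exact: reprK. Qed.

Lemma repr_tens_of s : tens_rel (repr (tens_of s)) s.
Proof. by apply/tens_ofP; rewrite tens_of_repr. Qed.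

Definition scale_word (a : R) (s : seq (X * Y)) := [seq (a *: p.1, p.2) | p <- s].

Lemma scale_word_rel a s t :
  tens_rel s t -> tens_rel (scale_word a s) (scale_word a t).
Proof.
elim=> {s t} /=.
- by move=> s; exact: tens_refl.
- by move=> s t _; exact: tens_sym.
- by move=> s t u _ h1 _; exact: tens_trans h1.
- by move=> s s' t t' _ h1 _ h2; rewrite /scale_word !map_cat; exact: tens_cat.
- by move=> s t; rewrite /scale_word !map_cat; exact: tens_catC.
- by move=> y; rewrite scaler0; exact: tens_zero.
- by move=> x x' y; rewrite scalerDr; exact: tens_addl.
- by move=> x y y'; exact: tens_addr.
- move=> b x y; rewrite scalerA mulrC -scalerA; exact: tens_scale.
Qed.

Definition tens_add (u v : tens) : tens := tens_of (repr u ++ repr v).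
Definition tens_opp (u : tens) : tens := tens_of (scale_word (-1) (repr u)).
Definition tens_smul (a : R) (u : tens) : tens := tens_of (scale_word a (repr u)).

Lemma tens_addE s t : tens_add (tens_of s) (tens_of t) = tens_of (s ++ t).
Proof. by apply/tens_ofP; apply: tens_cat; exact: repr_tens_of. Qed.

Lemma tens_smulE a s : tens_smul a (tens_of s) = tens_of (scale_word a s).
Proof. by apply/tens_ofP; apply: scale_word_rel; exact: repr_tens_of. Qed.

Lemma tens_addA : associative tens_add.
Proof.
move=> u v w; rewrite -(tens_of_repr u) -(tens_of_repr v) -(tens_of_repr w).
by rewrite !tens_addE catA.
Qed.

Lemma tens_addC : commutative tens_add.
Proof. by move=> u v; apply/tens_ofP; exact: tens_catC. Qed.

Lemma tens_add0 : left_id (tens_of [::]) tens_add.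
Proof. by move=> u; rewrite -(tens_of_repr u) tens_addE. Qed.

Lemma scale_word0 s : tens_rel (scale_word 0 s) [::].
Proof.
elim: s => [|[x y] s IHs] /=; first exact: tens_refl.
rewrite scale0r -cat1s -[X in tens_rel _ X]cats0.
by apply: tens_cat IHs; exact: tens_zero.
Qed.

Lemma scale_wordD a b s :
  tens_rel (scale_word (a + b) s) (scale_word a s ++ scale_word b s).
Proof.
elim: s => [|[x y] s IHs] /=; first exact: tens_refl.
rewrite scalerDl; apply: tens_trans.
  by rewrite -cat1s; exact: tens_cat (tens_addl _ _ _) IHs.
set A := scale_word a s; set B := scale_word b s.
set p := (a *: x, y); set q := (b *: x, y).
apply: (@tens_cat [:: p] [:: p] ([:: q] ++ (A ++ B)) (A ++ ([:: q] ++ B))).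
  exact: tens_refl.
rewrite !catA; apply: tens_cat; last exact: tens_refl.
exact: tens_catC.
Qed.

Lemma tens_addN : left_inverse (tens_of [::]) tens_opp tens_add.
Proof.
move=> u; rewrite -(tens_of_repr u) /tens_opp -/(tens_smul _ _) tens_smulE tens_addE.
apply/tens_ofP; set s := repr u.
apply: tens_trans (scale_word0 s).
rewrite -{2}[s]map_id -(addNr 1); apply: tens_sym.
apply: tens_trans (scale_wordD _ _ _) _.
apply: tens_cat; first exact: tens_refl.
rewrite (_ : scale_word 1 s = [seq i | i <- s]); first exact: tens_refl.
by apply: eq_map => -[x y] /=; rewrite scale1r.
Qed.

HB.instance Definition _ :=
  GRing.isZmodule.Build tens tens_addA tens_addC tens_add0 tens_addN.

Lemma tens_smulA a b u : tens_smul a (tens_smul b u) = tens_smul (a * b) u.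
Proof.
rewrite -(tens_of_repr u) !tens_smulE /scale_word -map_comp; congr tens_of.
by apply: eq_map => p /=; rewrite scalerA.
Qed.

Lemma tens_smul1 : left_id 1 tens_smul.
Proof.
move=> u; rewrite -(tens_of_repr u) tens_smulE; congr tens_of.
by rewrite -[RHS]map_id; apply: eq_map => -[x y] /=; rewrite scale1r.
Qed.

Lemma tens_smulDr : right_distributive tens_smul +%R.
Proof.
move=> a u v; rewrite -(tens_of_repr u) -(tens_of_repr v).
by rewrite [_ + _]tens_addE !tens_smulE [RHS]tens_addE /scale_word map_cat.
Qed.

Lemma tens_smulDl u : {morph tens_smul^~ u : a b / a + b}.
Proof.
move=> a b; rewrite -(tens_of_repr u) !tens_smulE [RHS]tens_addE.
by apply/tens_ofP; exact: scale_wordD.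
Qed.

HB.instance Definition _ := GRing.Zmodule_isLmodule.Build R tens
  tens_smulA tens_smul1 tens_smulDr tens_smulDl.

Definition tpure (x : X) (y : Y) : tens := tens_of [:: (x, y)].

Lemma tpureDl x x' y : tpure (x + x') y = tpure x y + tpure x' y.
Proof. by rewrite [RHS]tens_addE; apply/tens_ofP; exact: tens_addl. Qed.

Lemma tpureDr x y y' : tpure x (y + y') = tpure x y + tpure x y'.
Proof. by rewrite [RHS]tens_addE; apply/tens_ofP; exact: tens_addr. Qed.

Lemma tpureZl a x y : tpure (a *: x) y = a *: tpure x y.
Proof. by rewrite [RHS]tens_smulE. Qed.

Lemma tpureZr a x y : tpure x (a *: y) = a *: tpure x y.
Proof.
by rewrite -tpureZl; apply/tens_ofP; apply: tens_sym; exact: tens_scale.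
Qed.

Lemma tens_ofE s : tens_of s = \sum_(p <- s) tpure p.1 p.2.
Proof.
elim: s => [|[x y] s IHs]; first by rewrite big_nil.
by rewrite big_cons -IHs [RHS]tens_addE.
Qed.

Lemma tensE (t : tens) : t = \sum_(p <- repr t) tpure p.1 p.2.
Proof. by rewrite -tens_ofE tens_of_repr. Qed.

Lemma tens_ind (P : tens -> Prop) :
  P 0 -> (forall x y, P (tpure x y)) -> (forall u v, P u -> P v -> P (u + v)) ->
  forall t, P t.
Proof.
move=> P0 Pp PD t; rewrite (tensE t).
by apply: (big_ind P) => // p _; exact: Pp.
Qed.

Section Lift.
Variables (M : lmodType R) (f : X -> Y -> M).

Definition bilinear_map : Prop :=
  (forall y, linear (fun x => f x y)) /\ (forall x, linear (f x)).

Definition tlift_fun (t : tens) : M := \sum_(p <- repr t) f p.1 p.2.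

Hypothesis f_bil : bilinear_map.

Lemma tlift_of s : tlift_fun (tens_of s) = \sum_(p <- s) f p.1 p.2.
Proof.
have fl y x x' : f (x + x') y = f x y + f x' y.
  by have := f_bil.1 y 1 x x'; rewrite !scale1r.
have fr x y y' : f x (y + y') = f x y + f x y'.
  by have := f_bil.2 x 1 y y'; rewrite !scale1r.
have f0l y : f 0 y = 0.
  by apply: (@addrI _ (f 0 y)); rewrite -fl !addr0.
have f0r x : f x 0 = 0.
  by apply: (@addrI _ (f x 0)); rewrite -fr !addr0.
rewrite /tlift_fun; move: (repr_tens_of s); move: (repr _) => r.
elim=> {r s} //=.
- by move=> s t u _ -> _.
- by move=> s s' t t' _ IH1 _ IH2; rewrite !big_cat /= IH1 IH2.
- by move=> s t; rewrite !big_cat /= addrC.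
- by move=> y; rewrite big_seq1 big_nil f0l.
- by move=> x x' y; rewrite !big_cons !big_nil /= !addr0 fl.
- by move=> x y y'; rewrite !big_cons !big_nil /= !addr0 fr.
- move=> a x y; rewrite !big_seq1 /=.
  have := f_bil.1 y a x 0; rewrite !addr0 f0l addr0 => ->.
  by have := f_bil.2 x a y 0; rewrite !addr0 f0r addr0 => ->.
Qed.

Lemma tlift_linear : linear tlift_fun.
Proof.
move=> a u v; rewrite -(tens_of_repr u) -(tens_of_repr v).
rewrite [_ *: _]tens_smulE [_ + _]tens_addE !tlift_of big_cat /= big_map.
rewrite scaler_sumr; congr (_ + _); apply: eq_bigr => -[x y] _ /=.
have := f_bil.1 y 1 0 0; rewrite !scale1r !addr0 => /esym h0.
have := f_bil.1 y a x 0; rewrite !addr0 => ->.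
by rewrite -[RHS]addr0; congr (_ + _); apply: (@addrI _ (f 0 y)); rewrite h0 addr0.
Qed.

End Lift.

Definition tlift (M : lmodType R) (f : X -> Y -> M) (f_bil : bilinear_map f) :
    {linear tens -> M} :=
  HB.pack (tlift_fun f)
    (GRing.isLinear.Build R tens M *:%R (tlift_fun f) (tlift_linear f_bil)).

Lemma tliftE (M : lmodType R) (f : X -> Y -> M) (f_bil : bilinear_map f) x y :
  tlift f_bil (tpure x y) = f x y.
Proof. by rewrite /= tlift_of // big_seq1. Qed.

Lemma tens_lin_ext (M : lmodType R) (f g : {linear tens -> M}) :
  (forall x y, f (tpure x y) = g (tpure x y)) -> forall t, f t = g t.
Proof.
move=> fg; elim/tens_ind => //; first by rewrite !linear0.
by move=> u v fu fv; rewrite !linearD fu fv.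
Qed.

End Tensor.

Section TensorMap.
Variables (R : comPzRingType) (X X' Y Y' : lmodType R).
Variables (f : {linear X -> X'}) (g : {linear Y -> Y'}).

Lemma tmap_bil : bilinear_map (fun x y => tpure (f x) (g y)).
Proof.
by split=> [y|x] a u v; rewrite linearP ?tpureDl ?tpureDr ?tpureZl ?tpureZr.
Qed.

Definition tmap : {linear tens X Y -> tens X' Y'} := tlift tmap_bil.

Lemma tmapE x y : tmap (tpure x y) = tpure (f x) (g y).
Proof. exact: tliftE. Qed.

End TensorMap.

Section TensorAssoc.
Variables (R : comPzRingType) (X Y Z : lmodType R).

Lemma tassoc_bil_in (z : Z) :
  bilinear_map (fun (x : X) (y : Y) => tpure x (tpure y z)).
Proof.
by split=> [y|x] a u v; rewrite ?(tpureDl, tpureZl, tpureDr, tpureZr).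
Qed.

Lemma tassoc_bil :
  bilinear_map (fun (t : tens X Y) (z : Z) => tlift (tassoc_bil_in z) t).
Proof.
split=> [z|t] a u v; first exact: linearP.
elim/tens_ind: t => [|x y|t t' h h']; first by rewrite !linear0 addr0.
  by rewrite !tliftE !tpureDr !tpureZr.
by rewrite !linearD h h' addrACA.
Qed.

(* (x (x) y) (x) z |-> x (x) (y (x) z); bijective by tassoc_bij.              *)
Definition tassoc : {linear tens (tens X Y) Z -> tens X (tens Y Z)} :=
  tlift tassoc_bil.

Lemma tassocE x y z : tassoc (tpure (tpure x y) z) = tpure x (tpure y z).
Proof. by rewrite /tassoc tliftE tliftE. Qed.

Lemma tassoc_inv_bil_in (x : X) :
  bilinear_map (fun (y : Y) (z : Z) => tpure (tpure x y) z).
Proof.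
by split=> [z|y] a u v; rewrite ?(tpureDr, tpureZr, tpureDl, tpureZl).
Qed.

Lemma tassoc_inv_bil :
  bilinear_map (fun (x : X) (t : tens Y Z) => tlift (tassoc_inv_bil_in x) t).
Proof.
split=> [t|x] a u v; last exact: linearP.
elim/tens_ind: t => [|y z|t t' h h']; first by rewrite !linear0 addr0.
  by rewrite !tliftE !(tpureDl, tpureZl).
by rewrite !linearD h h' addrACA.
Qed.

Lemma tassoc_bij : bijective tassoc.
Proof.
exists (tlift tassoc_inv_bil); elim/tens_ind.
- by rewrite !linear0.
- move=> t z; elim/tens_ind: t => [|x y|t t' h h'].
  + by rewrite -(scale0r 0) tpureZl !linearZ /= !scale0r.
  + by rewrite tassocE !tliftE.
  + by rewrite tpureDl !linearD h h'.
- by move=> t t' h h'; rewrite !linearD h h'.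
- by rewrite !linear0.
- move=> x t; elim/tens_ind: t => [|y z|t t' h h'].
  + by rewrite -(scale0r 0) tpureZr !linearZ /= !scale0r.
  + by rewrite !tliftE.
  + by rewrite tpureDr !linearD h h'.
- by move=> t t' h h'; rewrite !linearD h h'.
Qed.

End TensorAssoc.

(* The element sum_h (a h) h of R[H] is represented by its coefficients a.    *)
Definition group_algebra (R : comPzRingType) (H : finGroupType) : Type :=
  {ffun H -> R}.

Definition galg_act (R : comPzRingType) (H : finGroupType) (V : lmodType R)
    (rho : H -> V -> V) (a : group_algebra R H) (v : V) : V :=
  \sum_(h : H) a h *: rho h v.

Definition fin_gen (R : comPzRingType) (G : finGroupType) (V : lmodType R)
    (rho : G -> V -> V) : Prop :=
  exists (n : nat) (s : 'I_n -> V), forall v : V,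
    exists c : 'I_n -> group_algebra R G, v = \sum_(i < n) galg_act rho (c i) (s i).

Record gmod (R : comPzRingType) (G : finGroupType) : Type := GMod {
  gmod_sort :> lmodType R;
  gmod_act : G -> {linear gmod_sort -> gmod_sort};
  gmod_act1 : forall x, gmod_act 1%g x = x;
  gmod_actM : forall g h x, gmod_act (g * h)%g x = gmod_act g (gmod_act h x);
  gmod_fin_gen : fin_gen gmod_act
}.

Record ghom (R : comPzRingType) (G : finGroupType) (X Y : gmod R G) : Type := GHom {
  ghom_fun :> {linear X -> Y};
  ghom_equiv : forall g x, ghom_fun (gmod_act X g x) = gmod_act Y g (ghom_fun x)
}.

Section Category.
Variables (R : comPzRingType) (G : finGroupType).

Lemma fin_genP (V : lmodType R) (rho : G -> V -> V) (I : finType) (s : I -> V) :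
    (forall x, rho 1%g x = x) ->
    (forall v, exists c : I -> R, v = \sum_i c i *: s i) ->
  fin_gen rho.
Proof.
move=> rho1 sP; exists #|I|, (fun i => s (enum_val i)) => v.
have [c ->] := sP v.
exists (fun i => [ffun g => if g == 1%g then c (enum_val i) else 0]).
rewrite (reindex _ (onW_bij _ (@enum_val_bij I))) /=; apply: eq_bigr => i _.
rewrite /galg_act (bigD1 1%g) //= ffunE eqxx rho1 big1 ?addr0 // => g /negPf ng.
by rewrite ffunE ng scale0r.
Qed.

Lemma gid_equiv (X : gmod R G) (g : G) (x : X) :
  (idfun : {linear X -> X}) (gmod_act X g x) = gmod_act X g ((idfun : {linear X -> X}) x).
Proof. by []. Qed.

Definition gid (X : gmod R G) : ghom X X := GHom (@gid_equiv X).

Section GTensor.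
Variables X Y : gmod R G.

Definition gtens_act (g : G) : {linear tens X Y -> tens X Y} :=
  tmap (gmod_act X g) (gmod_act Y g).

Lemma gtens_act1 t : gtens_act 1%g t = t.
Proof.
elim/tens_ind: t => [|x y|u v hu hv]; first by rewrite linear0.
  by rewrite tmapE !gmod_act1.
by rewrite linearD hu hv.
Qed.

Lemma gtens_actM g h t : gtens_act (g * h)%g t = gtens_act g (gtens_act h t).
Proof.
elim/tens_ind: t => [|x y|u v hu hv]; first by rewrite !linear0.
  by rewrite !tmapE !gmod_actM.
by rewrite !linearD hu hv.
Qed.

Lemma gtens_fin_gen : fin_gen gtens_act.
Proof.
have [m [s sP]] := gmod_fin_gen X; have [n [t tP]] := gmod_fin_gen Y.
pose I := ('I_m * G * ('I_n * G))%type.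
pose w (k : I) := tpure (gmod_act X k.1.2 (s k.1.1)) (gmod_act Y k.2.2 (t k.2.1)).
apply: (@fin_genP _ _ I w gtens_act1).
have suml (J : finType) (F : J -> X) (y : Y) :
    tpure (\sum_j F j) y = \sum_j tpure (F j) y.
  apply: (big_morph (fun x => tpure x y)) => [x x'|]; first exact: tpureDl.
  by rewrite -(scale0r 0) tpureZl scale0r.
have sumr (J : finType) (F : J -> Y) (x : X) :
    tpure x (\sum_j F j) = \sum_j tpure x (F j).
  apply: (big_morph (tpure x)) => [y y'|]; first exact: tpureDr.
  by rewrite -(scale0r 0) tpureZr scale0r.
elim/tens_ind => [|x y|u v [c ->] [d ->]].
- by exists (fun _ => 0); rewrite big1 // => k _; rewrite scale0r.
- have [c ->] := sP x; have [d ->] := tP y.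
  exists (fun k => c k.1.1 k.1.2 * d k.2.1 k.2.2).
  rewrite /galg_act !pair_big /= suml.
  rewrite (eq_bigr _ (fun j _ => sumr _ _ _)) pair_big /=.
  apply: eq_bigr => k _.
  by rewrite tpureZl tpureZr scalerA.
- exists (fun k => c k + d k); rewrite -big_split /=.
  by apply: eq_bigr => k _; rewrite scalerDl.
Qed.

(* X (x) Y with the diagonal action of G.                                     *)
Definition gtens : gmod R G := GMod gtens_act1 gtens_actM gtens_fin_gen.

(* The action (g, h) (x (x) y) = g x (x) h y of G x G on X (x) Y.             *)
Definition gtens_act2 (gh : G * G) : tens X Y -> tens X Y :=
  tmap (gmod_act X gh.1) (gmod_act Y gh.2).

End GTensor.

Section GTensorMap.
Variables (X X' Y Y' : gmod R G) (f : ghom X X') (f' : ghom Y Y').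

Lemma gtmap_equiv g t :
  tmap f f' (gmod_act (gtens X Y) g t) = gmod_act (gtens X' Y') g (tmap f f' t).
Proof.
change (tmap f f' (gtens_act X Y g t) = gtens_act X' Y' g (tmap f f' t)).
elim/tens_ind: t => [|x y|u v hu hv]; first by rewrite !linear0.
  by rewrite !tmapE !ghom_equiv.
by rewrite !linearD hu hv.
Qed.

Definition gtmap : ghom (gtens X Y) (gtens X' Y') :=
  @GHom R G (gtens X Y) (gtens X' Y') (tmap f f') gtmap_equiv.

End GTensorMap.

Section GTensorAssoc.
Variables X Y Z : gmod R G.

Lemma gassoc_equiv g t :
  tassoc X Y Z (gmod_act (gtens (gtens X Y) Z) g t) =
  gmod_act (gtens X (gtens Y Z)) g (tassoc X Y Z t).
Proof.
change (tassoc X Y Z (tmap (gtens_act X Y g) (gmod_act Z g) t) =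
        tmap (gmod_act X g) (gtens_act Y Z g) (tassoc X Y Z t)).
elim/tens_ind: t => [|t z|u v hu hv]; first by rewrite !linear0.
  elim/tens_ind: t => [|x y|u v hu hv].
  + by rewrite -(scale0r 0) tpureZl !linearZ /= !scale0r.
  + by rewrite !(tmapE, tassocE).
  + by rewrite tpureDl !linearD hu hv.
by rewrite !linearD hu hv.
Qed.

Definition gassoc : ghom (gtens (gtens X Y) Z) (gtens X (gtens Y Z)) :=
  @GHom R G (gtens (gtens X Y) Z) (gtens X (gtens Y Z)) (tassoc X Y Z)
    gassoc_equiv.

End GTensorAssoc.

End Category.

(* The coherence law is an equality of maps out of (X (x) Y) (x) Z, the two   *)
(* bracketings being identified through gassoc.                               *)
Record quantization (R : comPzRingType) (G : finGroupType) : Type := Quantization {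
  quant :> forall X Y : gmod R G, ghom (gtens X Y) (gtens X Y);
  quant_natural : forall (X X' Y Y' : gmod R G) (f : ghom X X') (f' : ghom Y Y')
      (t : gtens X Y),
    quant X' Y' (gtmap f f' t) = gtmap f f' (quant X Y t);
  quant_coherent : forall (X Y Z : gmod R G) (t : gtens (gtens X Y) Z),
    quant X (gtens Y Z) (gtmap (gid X) (quant Y Z) (gassoc X Y Z t)) =
    gassoc X Y Z (quant (gtens X Y) Z (gtmap (quant X Y) (gid Z) t))
}.

(* Main.v *)
Require Import Defs.
From HB Require Import structures.
From mathcomp Require Import all_fingroup.
From mathcomp Require Import all_boot all_order all_algebra.

(** The regular module R[G] represents the forgetful functor: a point x of a
    G-module X is the image of the unit under the unique equivariant map
    R[G] -> X, which is the orbit map a |-> a . x.  A natural transformation of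
    the tensor bifunctor is therefore determined by the one element
    Q (1 (x) 1) of R[G] (x) R[G] (a Yoneda argument in each variable):
    naturality along a pair of orbit maps turns Q (1 (x) 1) into Q (x (x) y).

    The basis vectors g (x) h span R[G] (x) R[G] ([tens_span]), so
    Q (1 (x) 1) is a combination of them; its coefficients q_{g,h} are the
    element of R[G x G] sought, because a pair of orbit maps sends g (x) h to
    g x (x) h y ([quant_orbit]). *)

Import GRing.Theory.
Local Open Scope ring_scope.

Set Implicit Arguments.
Unset Strict Implicit.
Unset Printing Implicit Defensive.

Section TensorSpan.
Variables (R : comPzRingType) (X Y : lmodType R) (I J : finType).
Variables (s : I -> X) (t : J -> Y).

Lemma tpure_suml (y : Y) (F : I -> X) :
  tpure (\sum_i F i) y = \sum_i tpure (F i) y.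
Proof.
apply: (big_morph (fun x => tpure x y)) => [x x'|]; first exact: tpureDl.
by rewrite -(scale0r 0) tpureZl scale0r.
Qed.

Lemma tpure_sumr (x : X) (F : J -> Y) :
  tpure x (\sum_j F j) = \sum_j tpure x (F j).
Proof.
apply: (big_morph (tpure x)) => [y y'|]; first exact: tpureDr.
by rewrite -(scale0r 0) tpureZr scale0r.
Qed.

Lemma tens_span :
    (forall x, exists c : I -> R, x = \sum_i c i *: s i) ->
    (forall y, exists d : J -> R, y = \sum_j d j *: t j) ->
  forall u : tens X Y, exists c : I * J -> R,
    u = \sum_k c k *: tpure (s k.1) (t k.2).
Proof.
move=> sP tP; elim/tens_ind => [|x y|u v [c ->] [d ->]].
- by exists (fun _ => 0); rewrite big1 // => k _; rewrite scale0r.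
- have [c ->] := sP x; have [d ->] := tP y.
  exists (fun k => c k.1 * d k.2); rewrite tpure_suml.
  under eq_bigr do rewrite tpure_sumr.
  by rewrite pair_big; apply: eq_bigr => k _; rewrite tpureZl tpureZr scalerA.
- exists (fun k => c k + d k); rewrite -big_split.
  by apply: eq_bigr => k _; rewrite scalerDl.
Qed.

End TensorSpan.

Section Regular.
Variables (R : comPzRingType) (G : finGroupType).

(** R[G] as a left R-module; R is taken as a module over itself so that
    functions into it inherit the pointwise module structure. *)
Definition regular : lmodType R := {ffun G -> R^o}.

Definition regular_basis (g : G) : regular := [ffun h => (h == g)%:R].

(** Left translation moves the basis vector h to g h, so in coordinates it
    precomposes with the inverse. *)
Definition regular_act_fun (g : G) (a : regular) : regular :=
  [ffun h => a (g^-1 * h)%g].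

Lemma regular_act_linear g : linear (regular_act_fun g).
Proof. by move=> k a b; apply/ffunP => h; rewrite !ffunE. Qed.

HB.instance Definition _ g := GRing.isLinear.Build R regular regular *:%R
  (regular_act_fun g) (regular_act_linear g).

Definition regular_act (g : G) : {linear regular -> regular} :=
  regular_act_fun g.

Lemma regular_act1 a : regular_act 1%g a = a.
Proof. by apply/ffunP => h; rewrite ffunE invg1 mul1g. Qed.

Lemma regular_actM g h a :
  regular_act (g * h)%g a = regular_act g (regular_act h a).
Proof. by apply/ffunP => k; rewrite !ffunE invMg mulgA. Qed.

Lemma regular_span (a : regular) :
  exists c : G -> R, a = \sum_g c g *: regular_basis g.
Proof.
exists a; apply/ffunP => h; rewrite sum_ffunE (bigD1 h) //= big1 => [|g ngh].
  by rewrite addr0 !ffunE eqxx [RHS]mulr1.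
by rewrite !ffunE eq_sym (negPf ngh) [LHS]mulr0.
Qed.

Definition regular_gmod : gmod R G :=
  GMod regular_act1 regular_actM
    (fin_genP regular_act1 regular_span).

Section Orbit.
Variables (X : gmod R G) (x : X).

Definition orbit_fun (a : regular) : X := galg_act (gmod_act X) a x.

Lemma orbit_linear : linear orbit_fun.
Proof.
move=> k a b; rewrite /orbit_fun /galg_act scaler_sumr -big_split.
by apply: eq_bigr => h _; rewrite !ffunE scalerDl scalerA.
Qed.

HB.instance Definition _ := GRing.isLinear.Build R regular X *:%R
  orbit_fun orbit_linear.

Lemma orbit_equiv g (a : regular_gmod) :
  orbit_fun (gmod_act regular_gmod g a) = gmod_act X g (orbit_fun a).
Proof.
rewrite /orbit_fun /galg_act linear_sum (reindex_inj (mulgI g)).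
by apply: eq_bigr => h _; rewrite ffunE mulKg gmod_actM linearZ.
Qed.

Definition orbit_map : ghom regular_gmod X :=
  @GHom R G regular_gmod X orbit_fun orbit_equiv.

Lemma orbit_basis g : orbit_map (regular_basis g) = gmod_act X g x.
Proof.
rewrite /= /orbit_fun /galg_act (bigD1 g) //= big1 => [|h nhg].
  by rewrite addr0 ffunE eqxx scale1r.
by rewrite ffunE (negPf nhg) scale0r.
Qed.

Lemma orbit_unit : orbit_map (regular_basis 1%g) = x.
Proof. by rewrite orbit_basis gmod_act1. Qed.

End Orbit.

Lemma gtmap_pure (X X' Y Y' : gmod R G) (f : ghom X X') (f' : ghom Y Y') x y :
  gtmap f f' (tpure x y) = tpure (f x) (f' y).
Proof. exact: tmapE. Qed.

(** Naturality of Q along the orbit maps of x and y, which send 1 (x) 1 to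
    x (x) y and g (x) h to g x (x) h y. *)
Lemma quant_orbit (Q : quantization R G) (c : G * G -> R) :
    Q regular_gmod regular_gmod
        (tpure (regular_basis 1%g) (regular_basis 1%g)) =
      \sum_k c k *: tpure (regular_basis k.1) (regular_basis k.2) ->
  forall (X Y : gmod R G) (x : X) (y : Y),
    Q X Y (tpure x y) =
      \sum_k c k *: tpure (gmod_act X k.1 x) (gmod_act Y k.2 y).
Proof.
move=> Qc X Y x y; rewrite -{1}(orbit_unit x) -{1}(orbit_unit y).
rewrite -gtmap_pure quant_natural Qc linear_sum; apply: eq_bigr => k _.
by rewrite linearZ -!orbit_basis -gtmap_pure.
Qed.

End Regular.

Theorem theorem1 (R : comPzRingType) (G : finGroupType) (Q : quantization R G) :
  exists q : group_algebra R (G * G)%type,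
    forall (X Y : gmod R G) (x : X) (y : Y),
      Q X Y (tpure x y) = galg_act (@gtens_act2 R G X Y) q (tpure x y) /\
      galg_act (@gtens_act2 R G X Y) q (tpure x y) =
        \sum_(g : G) \sum_(h : G) q (g, h) *: tpure (gmod_act X g x) (gmod_act Y h y).
Proof.
have [c Qc] := tens_span (@regular_span R G) (@regular_span R G)
  (Q (regular_gmod R G) (regular_gmod R G)
     (tpure (@regular_basis R G 1%g) (@regular_basis R G 1%g))).
exists [ffun k => c k] => X Y x y; split.
  rewrite (quant_orbit Qc) /galg_act; apply: eq_bigr => k _.
  by rewrite ffunE [gtens_act2 _ _]tmapE.
rewrite pair_big; apply: eq_bigr => -[g h] _.
by rewrite [gtens_act2 _ _]tmapE.
Qed.
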